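(* Suppose the data assumption stated in the context holds. Let $\mathcal{S}\subset\llbracket1,d_y\rrbracket$ be of size $r\in\llbracket0,r_{max}\rrbracket$ and let $Q=\llbracket1,d_y\rrbracket\setminus\mathcal{S}$. Let $D_{H-1}\in\mathbb{R}^{d_{H-1}\times d_{H-1}},\dots,D_1\in\mathbb{R}^{d_1\times d_1}$ be invertible matrices and let $Z_H\in\mathbb{R}^{(d_y-r)\times(d_{H-1}-r)}$, $Z_1\in\mathbb{R}^{(d_1-r)\times d_x}$ and $Z_h\in\mathbb{R}^{(d_h-r)\times(d_{h-1}-r)}$ for $h\in\llbracket2,H-1\rrbracket$. Let $\mathbf{W}=(W_H,\dots,W_1)$ be defined by $$W_H=[U_{\mathcal{S}},\,U_QZ_H]D_{H-1}^{-1},\qquad W_1=D_1\begin{bmatrix}U_{\mathcal{S}}^T\Sigma_{YX}\Sigma_{XX}^{-1}\\ Z_1\end{bmatrix},\qquad W_h=D_h\begin{bmatrix}I_r&0\\0&Z_h\end{bmatrix}D_{h-1}^{-1}\ \ \forall h\in\llbracket2,H-1\rrbracket.$$ If $r=r_{max}$, or if there exist $h_1\neq h_2$ such that $Z_{h_1}=0$ and $Z_{h_2}=0$, then $\mathbf{W}$ is a first-order critical point of $L$ associated with $\mathcal{S}$.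
   Context: Setting. Let $H\ge 2$ and let $d_0,\dots,d_H,m$ be positive integers; write $d_x=d_0$, $d_y=d_H$, $r_{max}=\min(d_H,\dots,d_0)$. Parameters are $\mathbf{W}=(W_H,\dots,W_1)$ with $W_h\in\mathbb{R}^{d_h\times d_{h-1}}$. Given data $X\in\mathbb{R}^{d_x\times m}$, $Y\in\mathbb{R}^{d_y\times m}$, the loss is $L(\mathbf{W})=\|W_H\cdots W_1X-Y\|^2$ (Frobenius norm). Set $\Sigma_{XX}=XX^T$, $\Sigma_{XY}=XY^T$, $\Sigma_{YX}=YX^T$. Data assumption. $d_y\le d_x\le m$, $\Sigma_{XX}$ is invertible, $\Sigma_{XY}$ has full rank $d_y$, and, with $\Sigma^{1/2}=\Sigma_{YX}\Sigma_{XX}^{-1}X\in\mathbb{R}^{d_y\times m}$ and $\Sigma=\Sigma^{1/2}(\Sigma^{1/2})^T=\Sigma_{YX}\Sigma_{XX}^{-1}\Sigma_{XY}$, the singular values of $\Sigma^{1/2}$ are all distinct (i.e. $\Sigma$ has $d_y$ distinct eigenvalues). Let $\Sigma^{1/2}=U\Delta V^T$ be a singular value decomposition with $U\in\mathbb{R}^{d_y\times d_y}$, $V\in\mathbb{R}^{m\times m}$ orthogonal and the diagonal entries of $\Delta\in\mathbb{R}^{d_y\times m}$ in decreasing order. Notation. $\llbracket a,b\rrbracket$ is the set of integers from $a$ to $b$ (empty if $a>b$). $A_{\mathcal{J}}$ is the submatrix of $A$ formed by the columns indexed by $\mathcal{J}$. $[A,B]$ is horizontal concatenation. Blocks may have 0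 rows or 0 columns (then they are absent); a product of a matrix with 0 columns and a matrix with 0 rows is the zero matrix of the appropriate size. A first-order critical point is a $\mathbf{W}$ with $\nabla L(\mathbf{W})=0$ (gradient with respect to all entries). For every first-order critical point $\mathbf{W}$, with $r=\operatorname{rk}(W_H\cdots W_1)$, there is a unique $\mathcal{S}\subset\llbracket 1,d_y\rrbracket$ of size $r$ such that $W_H\cdots W_1=U_{\mathcal{S}}U_{\mathcal{S}}^T\Sigma_{YX}\Sigma_{XX}^{-1}$; $\mathbf{W}$ is said to be associated with $\mathcal{S}$. *)

(* Defs.v *)
From HB Require Import structures.
From mathcomp Require Import all_boot all_order all_algebra.
From mathcomp Require Import all_classical all_reals all_analysis.

Set Implicit Arguments.
Unset Strict Implicit.
Unset Printing Implicit Defensive.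

Import Order.TTheory GRing.Theory Num.Theory.
Import numFieldNormedType.Exports.
Local Open Scope ring_scope.

(** The layer widths are d 0 = d_x, ..., d H = d_y. A parameter W stands for
    (W_H, ..., W_1): the entry [W h] is the matrix W_h of size d_h x d_{h-1}.
    Only the entries with 1 <= h <= H are meaningful; [W 0] and the entries
    beyond H are never looked at. *)
Definition params (R : realType) (d : nat -> nat) :=
  forall h : nat, 'M[R]_(d h, d h.-1).

Definition rmax (d : nat -> nat) (H : nat) : nat :=
  \big[minn/d 0%N]_(0 <= h < H.+1) d h.

(** [prodW W n] is W_n ... W_1. *)
Fixpoint prodW (R : realType) (d : nat -> nat) (W : params R d) (n : nat) :
    'M[R]_(d n, d 0%N) :=
  if n is k.+1 then W k.+1 *m prodW W k else 1%:M.

(** The norm on matrices provided by the analysis library is the sup norm,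
    hence this definition. *)
Definition frobenius_sq (R : realType) (p q : nat) (A : 'M[R]_(p, q)) : R :=
  \sum_i \sum_j A i j ^+ 2.

Definition loss (R : realType) (d : nat -> nat) (H m : nat)
    (X : 'M[R]_(d 0%N, m)) (Y : 'M[R]_(d H, m)) (W : params R d) : R :=
  frobenius_sq (prodW W H *m X - Y).

(** [perturb W h i j t] adds t to the entry (i, j) of W_h. The indices are
    compared as natural numbers because [i] has type ['I_(d h)] whereas the row
    index at layer [k] has type ['I_(d k)]. *)
Definition perturb (R : realType) (d : nat -> nat) (W : params R d)
    (h : nat) (i : 'I_(d h)) (j : 'I_(d h.-1)) (t : R) : params R d :=
  fun k => \matrix_(a, b)
    (if [&& k == h, a == i :> nat & b == j :> nat] then W k a b + t else W k a b).

(** The gradient of L at W vanishes: for every entry (i, j) of every W_h, the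
    partial derivative of L exists at W and is zero. *)
Definition first_order_critical (R : realType) (d : nat -> nat) (H m : nat)
    (X : 'M[R]_(d 0%N, m)) (Y : 'M[R]_(d H, m)) (W : params R d) : Prop :=
  forall (h : nat), (1 <= h <= H)%N -> forall (i : 'I_(d h)) (j : 'I_(d h.-1)),
    is_derive (0 : R) (1 : R) (fun t : R => loss X Y (perturb W i j t)) (0 : R).

Definition SigmaXX (R : realType) (p m : nat) (X : 'M[R]_(p, m)) : 'M[R]_p :=
  X *m X^T.

Definition SigmaXY (R : realType) (p q m : nat)
    (X : 'M[R]_(p, m)) (Y : 'M[R]_(q, m)) : 'M[R]_(p, q) := X *m Y^T.

Definition SigmaYX (R : realType) (p q m : nat)
    (X : 'M[R]_(p, m)) (Y : 'M[R]_(q, m)) : 'M[R]_(q, p) := Y *m X^T.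

Definition SigmaHalf (R : realType) (p q m : nat)
    (X : 'M[R]_(p, m)) (Y : 'M[R]_(q, m)) : 'M[R]_(q, m) :=
  SigmaYX X Y *m invmx (SigmaXX X) *m X.

Definition Sigma (R : realType) (p q m : nat)
    (X : 'M[R]_(p, m)) (Y : 'M[R]_(q, m)) : 'M[R]_q :=
  SigmaHalf X Y *m (SigmaHalf X Y)^T.

(** That the q singular values of SigmaHalf are distinct is expressed by Sigma
    having q distinct eigenvalues. *)
Definition data_assumption (R : realType) (p q m : nat)
    (X : 'M[R]_(p, m)) (Y : 'M[R]_(q, m)) : Prop :=
  [/\ (q <= p <= m)%N,
      SigmaXX X \in unitmx,
      \rank (SigmaXY X Y) = q &
      exists s : seq R,
        [/\ uniq s, size s = q & all (eigenvalue (Sigma X Y)) s] ].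

Definition is_svd (R : realType) (q m : nat) (A : 'M[R]_(q, m))
    (U : 'M[R]_q) (Delta : 'M[R]_(q, m)) (V : 'M[R]_m) : Prop :=
  [/\ A = U *m Delta *m V^T,
      U^T *m U = 1%:M,
      V^T *m V = 1%:M,
      is_diag_mx Delta /\
        (forall (i : 'I_q) (j : 'I_m), i = j :> nat -> 0 <= Delta i j) &
      forall (i i' : 'I_q) (j j' : 'I_m), i = j :> nat -> i' = j' :> nat ->
        (i <= i')%N -> Delta i' j' <= Delta i j].

(** A_J, with the columns kept in increasing order of their index. *)
Definition cols (R : realType) (p n : nat) (A : 'M[R]_(p, n)) (J : {set 'I_n}) :
    'M[R]_(p, #|J|) :=
  colsub (fun k : 'I_#|J| => enum_val k) A.

Lemma card_compl_ord (n : nat) (S : {set 'I_n}) : #|(~: S)%SET| = (n - #|S|)%N.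
Proof. by rewrite cardsCs finset.setCK card_ord. Qed.

(** A_Q for Q the complement of S, seen as a matrix with n - #|S| columns. *)
Definition cols_compl (R : realType) (p n : nat) (A : 'M[R]_(p, n))
    (S : {set 'I_n}) : 'M[R]_(p, n - #|S|) :=
  castmx (erefl p, card_compl_ord S) (cols A (~: S)%SET).

(** In the next three definitions, [conform_mx 0] only retypes a block matrix
    along r + (a - r) = a and r + (b - r) = b, where r <= a and r <= b; the
    default value 0 plays no role under these inequalities (see the lemmas
    that follow). *)

(** The block matrix [A, B]. *)
Definition hblock (R : realType) (q r b : nat)
    (A : 'M[R]_(q, r)) (B : 'M[R]_(q, b - r)) : 'M[R]_(q, b) :=
  conform_mx 0 (row_mx A B).

(** The block matrix [A ; B]. *)
Definition vblock (R : realType) (r a q : nat)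
    (A : 'M[R]_(r, q)) (B : 'M[R]_(a - r, q)) : 'M[R]_(a, q) :=
  conform_mx 0 (col_mx A B).

(** The block matrix [I_r, 0 ; 0, Z]. *)
Definition idblock (R : realType) (r a b : nat) (Z : 'M[R]_(a - r, b - r)) :
    'M[R]_(a, b) :=
  conform_mx 0 (block_mx (1%:M : 'M[R]_r) 0 0 Z).

Lemma conform_mx_castE (R : realType) (m n m' n' : nat)
    (em : m = m') (en : n = n') (B : 'M[R]_(m', n')) (A : 'M[R]_(m, n)) :
  conform_mx B A = castmx (em, en) A.
Proof. by case: m' / em B => B; case: n' / en B => B; rewrite conform_mx_id. Qed.

Lemma hblockE (R : realType) (q r b : nat) (rb : (r <= b)%N)
    (A : 'M[R]_(q, r)) (B : 'M[R]_(q, b - r)) :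
  hblock A B = castmx (erefl q, subnKC rb) (row_mx A B).
Proof. exact: conform_mx_castE. Qed.

Lemma vblockE (R : realType) (r a q : nat) (ra : (r <= a)%N)
    (A : 'M[R]_(r, q)) (B : 'M[R]_(a - r, q)) :
  vblock A B = castmx (subnKC ra, erefl q) (col_mx A B).
Proof. exact: conform_mx_castE. Qed.

Lemma idblockE (R : realType) (r a b : nat) (ra : (r <= a)%N) (rb : (r <= b)%N)
    (Z : 'M[R]_(a - r, b - r)) :
  idblock Z = castmx (subnKC ra, subnKC rb) (block_mx (1%:M : 'M[R]_r) 0 0 Z).
Proof. exact: conform_mx_castE. Qed.

(** The defining property of the set S attached to a critical point: it has size
    rk(W_H ... W_1), and W_H ... W_1 = U_S U_S^T SigmaYX SigmaXX^-1. *)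
Definition associated_with (R : realType) (d : nat -> nat) (H m : nat)
    (X : 'M[R]_(d 0%N, m)) (Y : 'M[R]_(d H, m)) (U : 'M[R]_(d H))
    (W : params R d) (S : {set 'I_(d H)}) : Prop :=
  #|S| = \rank (prodW W H) /\
  prodW W H = cols U S *m (cols U S)^T *m SigmaYX X Y *m invmx (SigmaXX X).

(** Z_1 has d_x columns while Z_h has d_{h-1} - r columns for h >= 2, so Z_1 is
    kept apart from the family Z (whose entries are used for 2 <= h <= H only). *)
Definition Zvanishes (R : realType) (d : nat -> nat) (r : nat)
    (Z1 : 'M[R]_(d 1%N - r, d 0%N)) (Z : forall h : nat, 'M[R]_(d h - r, d h.-1 - r))
    (h : nat) : Prop :=
  if h == 1%N then Z1 = 0 else Z h = 0.

(* Main.v *)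
Require Import Defs.
From HB Require Import structures.
From mathcomp Require Import all_boot all_order all_algebra.
From mathcomp Require Import all_classical all_reals all_analysis.
From mathcomp Require Import ring zify.

Set Implicit Arguments.
Unset Strict Implicit.
Unset Printing Implicit Defensive.

Import Order.TTheory GRing.Theory Num.Theory.
Import numFieldNormedType.Exports.
Local Open Scope ring_scope.

(** Why the construction gives critical points.

    Write C = U_S^T SigmaYX SigmaXX^-1 and let Ut = [U_S, U_Q], an orthogonal
    matrix. Since [U_S, U_Q Z_H] = Ut diag(I_r, Z_H), putting D_H := Ut makes
    every layer h >= 2 a conjugate D_h diag(I_r, Z_h) D_{h-1}^-1, so products of
    layers telescope ([prod_above_conj], [prodW_conj]):

      W_H ... W_{h+1} = Ut diag(I_r, Z_H ... Z_{h+1}) D_h^-1,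
      W_h ... W_1 = D_h [C ; Z_h ... Z_1].

    For h = H the second formula reads W_H ... W_1 = U_S C + U_Q Z_H ... Z_1. Its
    last term vanishes: when r = r_max is attained at an inner layer, the two Z
    next to that layer have no row or no column, hence are zero; when it is
    attained at an end, d_y <= d_x forces r = d_y, so Q is empty and U_Q has no
    column. Thus either U_Q = 0 or two of the Z vanish, and W is associated with
    S; the rank is r because SigmaYX SigmaXX^-1 has full row rank.

    The gradient of L in W_h is 2 A^T G B^T with A, B the products of the layers
    above and below h, and G = (W_H ... W_1 X - Y) X^T ([is_derive_loss]). Here
    G = U_S U_S^T SigmaYX - SigmaYX, whence U_S^T G = 0, and
    U_Q^T G C^T = - U_Q^T Sigma U_S = 0 because U diagonalises Sigma. What is left
    of A^T G B^T are terms containing (Z_H ... Z_{h+1})^T U_Q^T G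
    (Z_{h-1} ... Z_1)^T (no factor on the right when h = 1), and they vanish
    because at least one of the two zero matrices Z has an index different from h
    ([block_gradient_eq0]). *)

(** * The gradient of the loss *)

Lemma frobenius_sqE (R : realType) (p q : nat) (A : 'M[R]_(p, q)) :
  frobenius_sq A = \tr (A^T *m A).
Proof.
rewrite /frobenius_sq exchange_big /=; apply: eq_bigr => j _.
by rewrite mxE; apply: eq_bigr => i _; rewrite mxE expr2.
Qed.

Lemma frobenius_sqDZ (R : realType) (p q : nat) (A B : 'M[R]_(p, q)) (t : R) :
  frobenius_sq (A + t *: B) =
  frobenius_sq A + t * (2 * \tr (A^T *m B)) + t ^+ 2 * frobenius_sq B.
Proof.
have trC : \tr (B^T *m A) = \tr (A^T *m B).
  by rewrite -mxtrace_tr trmx_mul trmxK.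
have trDZ : (A + t *: B)^T = A^T + t *: B^T by rewrite linearD linearZ.
rewrite !frobenius_sqE trDZ mulmxDl !mulmxDr.
rewrite -!scalemxAl -!scalemxAr !mxtraceD !mxtraceZ trC; ring.
Qed.

(** A quadratic polynomial is differentiated through its formal derivative. *)
Lemma is_derive_quadratic (R : realType) (a b c : R) :
  is_derive (0 : R) (1 : R) (fun t : R => a + t * b + t ^+ 2 * c) b.
Proof.
pose p : {poly R} := a%:P + 'X * b%:P + 'X^2 * c%:P.
have -> : (fun t : R => a + t * b + t ^+ 2 * c) = horner p.
  by apply/funext => t; rewrite /p !hornerE.
have <- : (deriv p).[0] = b.
  rewrite /p !poly.derivE !hornerE /=.
  by rewrite ?expr0n ?mul0r ?mul0rn ?add0r ?addr0 ?mul1r.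
exact: is_derive_poly.
Qed.

Lemma mxtrace_mul_delta (R : realType) (p q : nat) (A : 'M[R]_(q, p)) i j :
  \tr (A *m delta_mx i j) = A j i.
Proof.
rewrite /mxtrace (bigD1 j) //= big1 ?addr0 => [|k kj]; rewrite mxE.
  rewrite (bigD1 i) //= big1 ?addr0 => [|l li]; rewrite mxE ?eqxx ?mulr1 //.
  by rewrite (negPf li) mulr0.
by rewrite big1 // => l _; rewrite mxE (negPf kj) andbF mulr0.
Qed.

(** The product W_{k+h} ... W_{h+1}. Indexing by the number k of factors makes the
    sizes compute, so that no cast between matrix types is needed. *)
Fixpoint prod_above (R : realType) (d : nat -> nat) (W : params R d) (h k : nat) :
    'M[R]_(d (k + h)%N, d h) :=
  if k is k'.+1 then W (k' + h).+1 *m prod_above W h k' else 1%:M.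

Lemma prodW_split (R : realType) (d : nat -> nat) (W : params R d) (h k : nat) :
  prodW W (k + h) = prod_above W h k *m prodW W h.
Proof.
by elim: k => [|k IH]; [rewrite mul1mx | rewrite -mulmxA -IH].
Qed.

Lemma eq_prodW (R : realType) (d : nat -> nat) (W W' : params R d) (n : nat) :
  (forall g : nat, (g <= n)%N -> W g = W' g) -> prodW W n = prodW W' n.
Proof.
elim: n => //= n IH eqW; rewrite eqW // IH // => g gn.
by apply: eqW; rewrite ltnW.
Qed.

Lemma eq_prod_above (R : realType) (d : nat -> nat) (W W' : params R d) (h k : nat) :
  (forall g : nat, (h < g)%N -> W g = W' g) -> prod_above W h k = prod_above W' h k.
Proof.
move=> eqW; elim: k => //= k ->; rewrite eqW //.
by rewrite ltnS leq_addl.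
Qed.

Lemma perturb_same (R : realType) (d : nat -> nat) (W : params R d) (h : nat)
    (i : 'I_(d h)) (j : 'I_(d h.-1)) (t : R) :
  perturb W i j t h = W h + t *: delta_mx i j.
Proof.
apply/matrixP => a b; rewrite !mxE eqxx /=.
by case: (_ && _); rewrite ?mulr1 ?mulr0 ?addr0.
Qed.

Lemma perturb_other (R : realType) (d : nat -> nat) (W : params R d) (h : nat)
    (i : 'I_(d h)) (j : 'I_(d h.-1)) (t : R) (g : nat) :
  g != h -> perturb W i j t g = W g.
Proof. by move=> gh; apply/matrixP => a b; rewrite mxE (negPf gh). Qed.

(** Moving one entry of W_{h+1} by t moves the residual E = W_H ... W_1 X - Y
    along the line E + t K with K = A delta_ij B X, so the loss is quadratic in t
    with linear coefficient 2 tr(E^T K); cyclicity of the trace identifies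
    tr(E^T K) with the entry (i, j) of A^T (E X^T) B^T. *)
Lemma is_derive_loss (R : realType) (d : nat -> nat) (h k m : nat)
    (X : 'M[R]_(d 0%N, m)) (Y : 'M[R]_(d (k + h.+1)%N, m)) (W : params R d)
    (i : 'I_(d h.+1)) (j : 'I_(d h)) :
  is_derive (0 : R) (1 : R)
    (fun t : R => loss X Y (@perturb R d W h.+1 i j t))
    (2 * ((prod_above W h.+1 k)^T *m
      ((prodW W (k + h.+1) *m X - Y) *m X^T) *m (prodW W h)^T) i j).
Proof.
set A := prod_above W h.+1 k; set B := prodW W h.
set E := prodW W (k + h.+1) *m X - Y.
pose K := A *m delta_mx i j *m B *m X.
have lossE t : loss X Y (@perturb R d W h.+1 i j t) =
    frobenius_sq E + t * (2 * \tr (E^T *m K)) + t ^+ 2 * frobenius_sq K.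
  rewrite -frobenius_sqDZ /loss; congr frobenius_sq.
  rewrite prodW_split (@eq_prod_above R d _ W h.+1) => [|g hg]; last first.
    by rewrite perturb_other // gtn_eqF.
  rewrite /= perturb_same (@eq_prodW R d _ W h) => [|g gh]; last first.
    by rewrite perturb_other // ltn_eqF.
  rewrite /E prodW_split /= -/A -/B /K !(mulmxDl, mulmxDr) -!scalemxAl -scalemxAr -scalemxAl.
  by rewrite !mulmxA addrAC.
have trE : \tr (E^T *m K) = (A^T *m (E *m X^T) *m B^T) i j.
  rewrite /K !mulmxA mxtrace_mulC !mulmxA mxtrace_mulC !mulmxA.
  rewrite mxtrace_mul_delta.
  have trmxE p q (N : 'M[R]_(p, q)) a b : N a b = N^T b a by rewrite mxE.
  by rewrite trmxE !trmx_mul !trmxK !mulmxA.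
rewrite -trE; have /funext -> := lossE.
exact: (is_derive_quadratic (frobenius_sq E) (2 * \tr (E^T *m K)) (frobenius_sq K)).
Qed.

(** * Calculus of the block matrices *)

(** Replacing the differences a - r by independent sizes lets the equations
    r + (a - r) = a be eliminated, which turns the casts into identities and
    reduces each lemma of this part to its counterpart for true block matrices. *)
Lemma mul_idblock (R : realType) (r a b c : nat) (ra : (r <= a)%N) (rb : (r <= b)%N)
    (rc : (r <= c)%N) (Z : 'M[R]_(a - r, b - r)) (Z' : 'M[R]_(b - r, c - r)) :
  idblock Z *m idblock Z' = idblock (Z *m Z').
Proof.
rewrite !idblockE.
move: (a - r)%N (subnKC ra) (b - r)%N (subnKC rb) (c - r)%N (subnKC rc) Z Z'.
move=> a' ea b' eb c' ec; case: a / ea {ra}; case: b / eb {rb}; case: c / ec {rc} => Z Z'.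
by rewrite !castmx_id mulmx_block !mulmx0 !mul0mx mulmx1 !addr0 add0r.
Qed.

Lemma idblock1 (R : realType) (r a : nat) (ra : (r <= a)%N) :
  @idblock R r a a 1%:M = 1%:M.
Proof.
rewrite !idblockE; move: (a - r)%N (subnKC ra) => a' ea; case: a / ea {ra}.
by rewrite castmx_id -scalar_mx_block.
Qed.

Lemma mul_idblock_vblock (R : realType) (r a b q : nat) (ra : (r <= a)%N)
    (rb : (r <= b)%N) (Z : 'M[R]_(a - r, b - r)) (A : 'M[R]_(r, q)) (B : 'M[R]_(b - r, q)) :
  idblock Z *m vblock A B = vblock A (Z *m B).
Proof.
rewrite !idblockE !vblockE.
move: (a - r)%N (subnKC ra) (b - r)%N (subnKC rb) Z B.
move=> a' ea b' eb; case: a / ea {ra}; case: b / eb {rb} => Z B.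
by rewrite !castmx_id mul_block_col !mul0mx mul1mx addr0 add0r.
Qed.

Lemma mul_hblock_idblock (R : realType) (r a b q : nat) (ra : (r <= a)%N)
    (rb : (r <= b)%N) (A : 'M[R]_(q, r)) (B : 'M[R]_(q, a - r)) (Z : 'M[R]_(a - r, b - r)) :
  hblock A B *m idblock Z = hblock A (B *m Z).
Proof.
rewrite !idblockE !hblockE.
move: (a - r)%N (subnKC ra) (b - r)%N (subnKC rb) Z B.
move=> a' ea b' eb; case: a / ea {ra}; case: b / eb {rb} => Z B.
by rewrite !castmx_id mul_row_block !mulmx0 mulmx1 addr0 add0r.
Qed.

Lemma mul_hblock_vblock (R : realType) (r a p q : nat) (ra : (r <= a)%N)
    (A : 'M[R]_(p, r)) (B : 'M[R]_(p, a - r)) (C : 'M[R]_(r, q)) (E : 'M[R]_(a - r, q)) :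
  hblock A B *m vblock C E = A *m C + B *m E.
Proof.
rewrite !hblockE !vblockE; move: (a - r)%N (subnKC ra) B E.
move=> a' ea; case: a / ea {ra} => B E.
by rewrite !castmx_id mul_row_col.
Qed.

Lemma tr_hblock (R : realType) (r a p : nat) (ra : (r <= a)%N)
    (A : 'M[R]_(p, r)) (B : 'M[R]_(p, a - r)) :
  (hblock A B)^T = vblock A^T B^T.
Proof.
rewrite !hblockE !vblockE; move: (a - r)%N (subnKC ra) B.
move=> a' ea; case: a / ea {ra} => B.
by rewrite !castmx_id tr_row_mx.
Qed.

Lemma mul_vblock_hblock (R : realType) (r a p q : nat) (ra : (r <= a)%N)
    (A : 'M[R]_(r, q)) (B : 'M[R]_(a - r, q)) (C : 'M[R]_(q, r)) (E : 'M[R]_(q, a - r)) :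
  A *m C = 1%:M -> A *m E = 0 -> B *m C = 0 -> B *m E = 1%:M ->
  @vblock R r a q A B *m hblock C E = 1%:M.
Proof.
rewrite !hblockE !vblockE; move: (a - r)%N (subnKC ra) B E.
move=> a' ea; case: a / ea {ra} => B E AC AE BC BE.
by rewrite !castmx_id mul_col_row AC AE BC BE -scalar_mx_block.
Qed.

Lemma mul_vblock (R : realType) (r a p q : nat) (ra : (r <= a)%N)
    (A : 'M[R]_(r, p)) (B : 'M[R]_(a - r, p)) (G : 'M[R]_(p, q)) :
  vblock A B *m G = vblock (A *m G) (B *m G).
Proof.
rewrite !vblockE; move: (a - r)%N (subnKC ra) B.
move=> a' ea; case: a / ea {ra} => B.
by rewrite !castmx_id mul_col_mx.
Qed.

Lemma vblock0 (R : realType) (r a p : nat) (ra : (r <= a)%N) :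
  @vblock R r a p 0 0 = 0.
Proof.
have := @mul_vblock R r a p p ra 0 0 0.
by rewrite !mulmx0.
Qed.

(** * Columns of the orthogonal factor *)

Definition compl_val (n : nat) (S : {set 'I_n}) (k : 'I_(n - #|S|)) : 'I_n :=
  enum_val (cast_ord (esym (card_compl_ord S)) k).
Arguments compl_val {n} S k.

Lemma cols_complE (R : realType) (p n : nat) (A : 'M[R]_(p, n)) (S : {set 'I_n}) :
  cols_compl A S = colsub (compl_val S) A.
Proof. by apply/matrixP => i j; rewrite castmxE !mxE cast_ord_id. Qed.

Lemma compl_valP {n : nat} (S : {set 'I_n}) (k : 'I_(n - #|S|)) :
  compl_val S k \notin S.
Proof.
have := enum_valP (cast_ord (esym (card_compl_ord S)) k).
by rewrite inE.
Qed.

Lemma compl_val_inj {n : nat} (S : {set 'I_n}) : injective (compl_val S).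
Proof. by move=> i j /enum_val_inj /cast_ord_inj. Qed.

(** Orthogonality of eigenvectors for the form B becomes a statement on the
    entries of the full matrix A^T B A. *)
Lemma gram_colsub (R : realType) (n p q : nat) (f : 'I_p -> 'I_n) (g : 'I_q -> 'I_n)
    (A B : 'M[R]_n) :
  (colsub f A)^T *m B *m colsub g A = mxsub f g (A^T *m B *m A).
Proof.
by rewrite trmx_mxsub mul_rowsub_mx mul_rowsub_mx mulmx_colsub -mxsub_comp.
Qed.

Lemma colsub_orthonormal (R : realType) (n p : nat) (f : 'I_p -> 'I_n) (U : 'M[R]_n) :
  U^T *m U = 1%:M -> injective f -> (colsub f U)^T *m colsub f U = 1%:M.
Proof.
move=> UU f_inj; rewrite -[X in X *m _]mulmx1 gram_colsub mulmx1 UU.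
by apply/matrixP => i j; rewrite !mxE inj_eq.
Qed.

Lemma colsub_diag_eq0 (R : realType) (n p q : nat) (f : 'I_p -> 'I_n) (g : 'I_q -> 'I_n)
    (U B : 'M[R]_n) :
  is_diag_mx (U^T *m B *m U) -> (forall i j, f i != g j) ->
  (colsub f U)^T *m B *m colsub g U = 0.
Proof.
move=> /is_diag_mxP dB fg; rewrite gram_colsub.
by apply/matrixP => i j; rewrite [LHS]mxE [RHS]mxE dB //; apply: fg.
Qed.

Lemma colsub_orthogonal (R : realType) (n p q : nat) (f : 'I_p -> 'I_n) (g : 'I_q -> 'I_n)
    (U : 'M[R]_n) :
  U^T *m U = 1%:M -> (forall i j, f i != g j) -> (colsub f U)^T *m colsub g U = 0.
Proof.
move=> UU fg; rewrite -[X in X *m _]mulmx1 colsub_diag_eq0 // mulmx1 UU.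
exact: scalar_mx_is_diag.
Qed.

(** * Minimal layer width *)

Lemma bigminn_bounds_attained (x : nat) (F : nat -> nat) (s : seq nat) :
  let b := \big[minn/x]_(i <- s) F i in
  [/\ (b <= x)%N, forall i, i \in s -> (b <= F i)%N & b = x \/ exists2 i, i \in s & b = F i].
Proof.
elim: s => [|j s [bx bF bE]] /=; first by rewrite big_nil; split=> //; left.
rewrite big_cons; set b := bigop _ _ _ in bx bF bE *; split.
- by rewrite geq_min bx orbT.
- move=> i; rewrite inE => /predU1P[->|/bF]; first by rewrite geq_minl.
  by move=> le; rewrite geq_min le orbT.
rewrite /minn; case: ifP => _; first by right; exists j; rewrite ?mem_head.
case: bE => [->|[i si ->]]; [by left | right; exists i => //].
by rewrite inE si orbT.
Qed.

Lemma rmax_le (d : nat -> nat) (H h : nat) : (h <= H)%N -> (rmax d H <= d h)%N.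
Proof.
move=> hH; have [_ le _] := bigminn_bounds_attained (d 0%N) d (index_iota 0 H.+1).
by apply: le; rewrite mem_index_iota.
Qed.

Lemma rmax_attained (d : nat -> nat) (H : nat) :
  exists2 h : nat, (h <= H)%N & rmax d H = d h.
Proof.
have [_ _ [e|[h]]] := bigminn_bounds_attained (d 0%N) d (index_iota 0 H.+1).
  by exists 0%N.
by rewrite mem_index_iota => hH e; exists h.
Qed.

(** * Telescoping products of layers *)

Lemma prod_above_eq0 (R : realType) (d : nat -> nat) (W : params R d) (h k g : nat) :
  (h < g <= k + h)%N -> W g = 0 -> prod_above W h k = 0.
Proof.
move=> + W0; elim: k => [|k IH] /andP[hg gk].
  by move: (leq_trans hg gk); rewrite ltnn.
rewrite /=; have [eg | ne] := eqVneq g (k + h).+1.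
  by subst g; rewrite W0 mul0mx.
by rewrite IH ?mulmx0 // hg /=; rewrite leq_eqVlt (negPf ne) in gk.
Qed.

(** The inner factors D_g^-1 D_g cancel. For k = 0 the right-hand side is
    D_h I D_h^-1, which is why D_h must be invertible up to the last layer. *)
Lemma prod_above_conj (R : realType) (d : nat -> nat) (r H : nat)
    (hr : forall h : nat, (h <= H)%N -> (r <= d h)%N)
    (W : params R d) (D : forall h : nat, 'M[R]_(d h))
    (hD : forall h : nat, (1 <= h <= H)%N -> D h \in unitmx)
    (Z : forall h : nat, 'M[R]_(d h - r, d h.-1 - r))
    (hW : forall h : nat, (2 <= h <= H)%N ->
       W h = D h *m idblock (Z h) *m invmx (D h.-1)) (h k : nat) :
  (1 <= h)%N -> (k + h <= H)%N ->
  prod_above W h k =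
    D (k + h)%N *m idblock (@prod_above R (fun g => d g - r)%N Z h k) *m invmx (D h).
Proof.
move=> h0; elim: k => [|k IH] kH.
  by rewrite idblock1 ?hr // mulmx1 mulmxV // hD // h0.
have kH' : (k + h <= H)%N by rewrite ltnW.
rewrite /= hW ?IH //=; last by rewrite kH ltnS (leq_trans h0) ?leq_addl.
rewrite -!mulmxA; congr (_ *m _); rewrite !mulmxA mulmxKV; last first.
  by rewrite hD // kH' andbT (leq_trans h0) ?leq_addl.
by rewrite mul_idblock ?hr // (leq_trans _ kH') ?leq_addl.
Qed.

Lemma prodW_conj (R : realType) (d : nat -> nat) (r H : nat)
    (hr : forall h : nat, (h <= H)%N -> (r <= d h)%N)
    (W : params R d) (D : forall h : nat, 'M[R]_(d h))
    (hD : forall h : nat, (1 <= h <= H)%N -> D h \in unitmx)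
    (C : 'M[R]_(r, d 0%N)) (Z1 : 'M[R]_(d 1%N - r, d 0%N))
    (Z : forall h : nat, 'M[R]_(d h - r, d h.-1 - r))
    (hW1 : W 1%N = D 1%N *m vblock C Z1)
    (hW : forall h : nat, (2 <= h <= H)%N ->
       W h = D h *m idblock (Z h) *m invmx (D h.-1)) (k : nat) :
  (k + 1 <= H)%N ->
  prodW W (k + 1) =
    D (k + 1)%N *m vblock C (@prod_above R (fun g => d g - r)%N Z 1 k *m Z1).
Proof.
move=> kH; have H1 : (1 <= H)%N by rewrite (leq_trans _ kH) ?leq_addl.
rewrite prodW_split (prod_above_conj hr hD hW) //= mulmx1 hW1.
by rewrite mulmxA mulmxKV ?hD // -!mulmxA mul_idblock_vblock ?hr.
Qed.

Lemma Zvanishes_above (R : realType) (d : nat -> nat) (r : nat)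
    (Z1 : 'M[R]_(d 1%N - r, d 0%N)) (Z : forall h : nat, 'M[R]_(d h - r, d h.-1 - r))
    (h k g : nat) :
  (1 <= h)%N -> (h < g <= k + h)%N -> Zvanishes Z1 Z g ->
  @prod_above R (fun g => d g - r)%N Z h k = 0.
Proof.
move=> h0 hg; rewrite /Zvanishes ifN => [Zg|].
  exact: (@prod_above_eq0 _ (fun g => d g - r)%N Z h k g).
by case/andP: hg => hg _; rewrite gtn_eqF // (leq_ltn_trans h0).
Qed.

Lemma Zvanishes_below (R : realType) (d : nat -> nat) (r : nat)
    (Z1 : 'M[R]_(d 1%N - r, d 0%N)) (Z : forall h : nat, 'M[R]_(d h - r, d h.-1 - r))
    (k g : nat) :
  (1 <= g <= k + 1)%N -> Zvanishes Z1 Z g ->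
  @prod_above R (fun g => d g - r)%N Z 1 k *m Z1 = 0.
Proof.
move=> /andP[g0 gk]; have [-> /= ->|g1 Zg] := eqVneq g 1%N; first by rewrite mulmx0.
by rewrite (@Zvanishes_above _ _ _ Z1 _ _ _ g) ?mul0mx // gk andbT ltn_neqAle eq_sym g1.
Qed.

(** * Rank and gradient of the structured product *)

Lemma matrix_no_row (R : realType) (p q : nat) (A : 'M[R]_(p, q)) : p = 0%N -> A = 0.
Proof. by move=> p0; subst p; apply: flatmx0. Qed.

Lemma matrix_no_col (R : realType) (p q : nat) (A : 'M[R]_(p, q)) : q = 0%N -> A = 0.
Proof. by move=> q0; subst q; apply: thinmx0. Qed.

(** The rank of A A^T is at most r, and at least that of A^T (A A^T) A = I_r. *)
Lemma rank_mul_orthonormal (R : realType) (p q r : nat) (A : 'M[R]_(p, r)) (M : 'M[R]_(p, q)) :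
  A^T *m A = 1%:M -> row_free M -> \rank (A *m A^T *m M) = r.
Proof.
move=> AA freeM; rewrite mxrankMfree //; apply/eqP; rewrite eqn_leq.
rewrite (leq_trans (mxrankM_maxl _ _)) ?rank_leq_col //=.
have e : A^T *m (A *m A^T) *m A = 1%:M by rewrite mulmxA AA mul1mx.
rewrite -[X in (X <= _)%N](mxrank1 R) -e.
exact: leq_trans (mxrankM_maxl _ _) (mxrankM_maxr _ _).
Qed.

(** With A = U Delta V^T one gets U^T (A A^T) U = Delta Delta^T, and
    Delta Delta^T is diagonal because Delta is. *)
Lemma svd_Sigma_diag (R : realType) (p q m : nat)
    (X : 'M[R]_(p, m)) (Y : 'M[R]_(q, m))
    (U : 'M[R]_q) (Delta : 'M[R]_(q, m)) (V : 'M[R]_m) :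
  is_svd (SigmaHalf X Y) U Delta V -> is_diag_mx (U^T *m Sigma X Y *m U).
Proof.
move=> [eA UU VV [/is_diag_mxP dD _] _].
have -> : U^T *m Sigma X Y *m U = Delta *m Delta^T.
  rewrite /Sigma eA !trmx_mul trmxK !mulmxA UU mul1mx.
  rewrite -(mulmxA _ V^T) VV mulmx1.
  by rewrite -(mulmxA _ U^T) UU mulmx1.
apply/is_diag_mxP => i j ij; rewrite mxE big1 // => k _; rewrite !mxE.
have [ik|ik] := eqVneq (i : nat) k; last by rewrite dD ?mul0r.
by rewrite (dD j k) ?mulr0 // -ik eq_sym.
Qed.

(** Both sides are SigmaYX SigmaXX^-1 SigmaXY; this form avoids the symmetry of
    the inverse. *)
Lemma SigmaE (R : realType) (p q m : nat) (X : 'M[R]_(p, m)) (Y : 'M[R]_(q, m)) :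
  SigmaXX X \in unitmx ->
  Sigma X Y = SigmaYX X Y *m (SigmaYX X Y *m invmx (SigmaXX X))^T.
Proof.
move=> uX; rewrite /Sigma /SigmaHalf trmx_mul !mulmxA -(mulmxA _ X) -/(SigmaXX X).
by rewrite mulmxKV.
Qed.

(** Transposing the layers above h turns [US, UQ Zs] into the two block rows
    US^T and Zs^T UQ^T: the gradient is zero as soon as each of them
    contributes zero. *)
Lemma block_gradient_eq0 (R : realType) (r p q n l : nat) (rp : (r <= p)%N)
    (rq : (r <= q)%N) (US : 'M[R]_(q, r)) (UQ : 'M[R]_(q, q - r))
    (Zs : 'M[R]_(q - r, p - r)) (Di : 'M[R]_p) (G : 'M[R]_(q, n)) (B : 'M[R]_(l, n)) :
  US^T *m G = 0 -> Zs^T *m (UQ^T *m G) *m B^T = 0 ->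
  (hblock US UQ *m idblock Zs *m Di)^T *m G *m B^T = 0.
Proof.
move=> USG ZG; rewrite mul_hblock_idblock // trmx_mul tr_hblock // -!mulmxA.
rewrite mul_vblock // mulmxA USG mul0mx trmx_mul -!mulmxA (mulmxA _ G).
by rewrite (mulmxA Zs^T) ZG vblock0 ?mulmx0.
Qed.

(** * Critical points *)

Theorem proposition10 (R : realType) (H m : nat) (d : nat -> nat)
    (hH : (2 <= H)%N) (hm : (0 < m)%N)
    (hd : forall h : nat, (h <= H)%N -> (0 < d h)%N)
    (X : 'M[R]_(d 0%N, m)) (Y : 'M[R]_(d H, m))
    (hXY : data_assumption X Y)
    (U : 'M[R]_(d H)) (Delta : 'M[R]_(d H, m)) (V : 'M[R]_m)
    (hsvd : is_svd (SigmaHalf X Y) U Delta V)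
    (S : {set 'I_(d H)}) (hS : (#|S| <= rmax d H)%N)
    (D : forall h : nat, 'M[R]_(d h))
    (hD : forall h : nat, (1 <= h <= H.-1)%N -> D h \in unitmx)
    (Z1 : 'M[R]_(d 1%N - #|S|, d 0%N))
    (Z : forall h : nat, 'M[R]_(d h - #|S|, d h.-1 - #|S|))
    (W : params R d)
    (hWH : W H = hblock (cols U S) (cols_compl U S *m Z H) *m invmx (D H.-1))
    (hW1 : W 1%N = D 1%N *m vblock ((cols U S)^T *m SigmaYX X Y *m invmx (SigmaXX X)) Z1)
    (hWh : forall h : nat, (2 <= h <= H.-1)%N ->
       W h = D h *m idblock (Z h) *m invmx (D h.-1))
    (hZ : #|S| = rmax d H \/
       exists h1 h2 : nat, [/\ (1 <= h1 <= H)%N, (1 <= h2 <= H)%N, h1 != h2,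
         Zvanishes Z1 Z h1 & Zvanishes Z1 Z h2]) :
  first_order_critical X Y W /\ associated_with X Y U W S.
Proof.
have [/andP[dyx _] uX rkXY _] := hXY.
have [_ UU _ _ _] := hsvd.
have Sdiag := svd_Sigma_diag hsvd.
have hr h : (h <= H)%N -> (#|S| <= d h)%N by move=> /(rmax_le d); apply: leq_trans.
move: (hr H (leqnn H)) => rH.
set r := #|S| in Z1 Z hWH hW1 hWh hZ hr hS rH *.
have eQ := cols_complE U S.
set US := cols U S in hWH hW1 *; set UQ := cols_compl U S in hWH eQ.
have eS : US = colsub (fun k : 'I_r => enum_val k) U by [].
have ed i (j : 'I_#|S|) : compl_val S i != enum_val j.
  by apply: contraNneq (compl_valP i) => ->; exact: (enum_valP j).
have ed' (j : 'I_#|S|) i : enum_val j != compl_val S i by rewrite eq_sym.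
have SS : US^T *m US = 1%:M by rewrite eS colsub_orthonormal // => x y /enum_val_inj.
have QQ : UQ^T *m UQ = 1%:M by rewrite eQ colsub_orthonormal //; apply: compl_val_inj.
have SQ : US^T *m UQ = 0 by rewrite eS eQ colsub_orthogonal.
have QS : UQ^T *m US = 0 by rewrite eS eQ colsub_orthogonal.
have QSigS : UQ^T *m Sigma X Y *m US = 0 by rewrite eS eQ colsub_diag_eq0.
set M := SigmaYX X Y *m invmx (SigmaXX X).
set C := US^T *m SigmaYX X Y *m invmx (SigmaXX X) in hW1.
have CE : C = US^T *m M by rewrite /C -mulmxA.
(* The extremal case r = r_max is reduced to the other one, up to the degenerate
   situation where Q is empty. *)
have hZ' : UQ = 0 \/
    exists h1 h2 : nat, [/\ (1 <= h1 <= H)%N, (1 <= h2 <= H)%N, h1 != h2,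
         Zvanishes Z1 Z h1 & Zvanishes Z1 Z h2].
  case: hZ => [rmaxE|]; last by right.
  have [g gH eg] := rmax_attained d H; rewrite -rmaxE in eg.
  have [eH|nH] := eqVneq (d H) r; first by left; apply: matrix_no_col; lia.
  (* Z_g has d_g - r = 0 rows and Z_{g+1} has d_g - r = 0 columns. *)
  right; exists g, g.+1; rewrite /Zvanishes.
  have gneH : g != H by apply: contraNneq nH => <-; rewrite eg.
  have g0 : g != 0%N by apply: contraNneq nH => g0; move: dyx rH; rewrite -g0; lia.
  split; try lia.
    case: eqP => g1; last by apply: matrix_no_row; lia.
    by apply: matrix_no_row; rewrite -g1; lia.
  rewrite ifN; last by lia.
  by apply: matrix_no_col => /=; lia.
pose Ut := @hblock R (d H) r (d H) US UQ.
have uUt : Ut \in unitmx.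
  have: Ut^T *m Ut = 1%:M by rewrite tr_hblock // mul_vblock_hblock.
  by case/mulmx1_unit.
(* The last change of basis is Ut, so that layer H has the form of the inner
   ones. *)
have [D' [D'H D'D]] : exists D' : forall h, 'M[R]_(d h),
    D' H = Ut /\ forall h, h != H -> D' h = D h.
  exists (dfwith D H Ut); split; first by rewrite dfwithin.
  by move=> h hneq; rewrite dfwithout // eq_sym.
have hD' h : (1 <= h <= H)%N -> D' h \in unitmx.
  move=> /andP[h0 hH']; have [->|ne] := eqVneq h H; first by rewrite D'H.
  by rewrite D'D // hD // h0 -ltnS prednK ?(ltnW hH) // ltn_neqAle ne.
have hWh' h : (2 <= h <= H)%N -> W h = D' h *m idblock (Z h) *m invmx (D' h.-1).
  move=> /andP[h2 hH']; have ne1 : h.-1 != H by lia.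
  rewrite (D'D h.-1) //; have [e|ne] := eqVneq h H.
    subst h; rewrite D'H hWH mul_hblock_idblock ?hr //; lia.
  by rewrite D'D // hWh //; lia.
have hW1' : W 1%N = D' 1%N *m vblock C Z1 by rewrite D'D //; lia.
clear hWH hW1 hWh hZ hD.
have suffixE := prod_above_conj hr hD' hWh'.
have prefixE := prodW_conj hr hD' hW1' hWh'.
(* The term U_Q Z_H ... Z_1 of the full product is zero. *)
have PE : prodW W H = US *m C.
  have [k Hk] : exists k, H = (k + 1)%N by exists H.-1; lia.
  subst H.
  have zero : UQ *m (@prod_above R (fun g => d g - r)%N Z 1 k *m Z1) = 0.
    case: hZ' => [->|[g [_ [gH _ _ Zg _]]]]; first by rewrite mul0mx.
    by rewrite (Zvanishes_below _ Zg) ?mulmx0.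
  rewrite prefixE // D'H /Ut mul_hblock_vblock //.
  by rewrite zero addr0.
split; last first.
  split; last by rewrite PE /C !mulmxA.
  rewrite PE CE mulmxA rank_mul_orthonormal //.
  rewrite /row_free /M mxrankMfree; last by rewrite row_free_unit unitmx_inv.
  apply/eqP; rewrite -[RHS]rkXY -[RHS]mxrank_tr.
  by rewrite /SigmaXY /SigmaYX trmx_mul trmxK.
have GE : (prodW W H *m X - Y) *m X^T = US *m US^T *m SigmaYX X Y - SigmaYX X Y.
  rewrite PE mulmxBl -/(SigmaYX X Y) -(mulmxA _ X) -/(SigmaXX X).
  by rewrite -(mulmxA US) /C mulmxKV // mulmxA.
have SG : US^T *m ((prodW W H *m X - Y) *m X^T) = 0.
  by rewrite GE mulmxBr !mulmxA SS mul1mx subrr.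
have QG : UQ^T *m ((prodW W H *m X - Y) *m X^T) *m C^T = 0.
  rewrite GE mulmxBr (mulmxA UQ^T (US *m US^T)) (mulmxA UQ^T US) QS !mul0mx sub0r.
  rewrite CE trmx_mul trmxK mulNmx (mulmxA _ M^T) -(mulmxA UQ^T _ M^T) /M.
  by rewrite -SigmaE // QSigS oppr0.
move=> [//|h] hH1 i j.
have [k Hk] : exists k, H = (k + h.+1)%N by exists (H - h.+1)%N; lia.
subst H.
have := is_derive_loss X Y W i j.
rewrite suffixE // D'H /Ut block_gradient_eq0 ?hr //; last first.
  case: hZ' => [->|[h1 [h2 [h1H h2H h12 Zh1 Zh2]]]].
    by rewrite trmx0 mul0mx mulmx0 mul0mx.
  (* Two distinct layers have a zero Z, hence one of them is not the layer
     h.+1 being differentiated. *)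
  have [g [gH gh Zg]] : exists g, [/\ (1 <= g <= k + h.+1)%N, g != h.+1 & Zvanishes Z1 Z g].
    have [e|ne] := eqVneq h1 h.+1; last by exists h1.
    by exists h2; split; rewrite // -e eq_sym.
  have [gh'|hg] := leqP g h.+1; last first.
    by rewrite (Zvanishes_above _ _ Zg) ?trmx0 ?mul0mx // hg; case/andP: gH.
  have [l hl] : exists l, h = (l + 1)%N by exists h.-1; lia.
  subst h; rewrite prefixE; last by lia.
  rewrite (Zvanishes_below _ Zg); last by lia.
  (* Factoring C out on the right brings C^T next to U_Q^T G. *)
  have -> : vblock C 0 = vblock 1%:M 0 *m C :> 'M[R]_(d (l + 1)%N, d 0%N).
    by rewrite mul_vblock ?mul1mx ?mul0mx // hr //; lia.
  rewrite trmx_mul [(_ *m C)^T]trmx_mul.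
  by rewrite -(mulmxA C^T) -mulmxA (mulmxA _ C^T) QG mul0mx mulmx0.
by rewrite mxE mulr0.
Qed.
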